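(* Let $M$ be a compact differential manifold, let $N$ be an $n$-dimensional connected noncompact differential manifold, and let $f:M\to N$ be a $C^1$-map. Then either all points of $M$ are critical points of $f$, or the set $C_f\subset M$ of all critical points of $f$ satisfies $\dim C_f\geq n-1$.
   Context: Differential manifolds are smooth manifolds without boundary in the usual sense (Hausdorff, second countable). A point $p\in M$ is a critical point of a $C^1$-map $f:M\to N$ if the differential $df_p:T_pM\to T_{f(p)}N$ is not surjective. Dimension of subsets: write $m=\dim M$ and let $\mathcal H^s$ denote the $s$-dimensional Hausdorff measure on $\mathbb R^m$. A subset $E$ of an $m$-dimensional differential manifold $M$ is said to be of $\mathcal H^s$-measure zero if $\mathcal H^s(\varphi(E\cap U))=0$ for every coordinate chart $(U,\varphi)$ of $M$. The dimension of $E$ is $\dim E=\inf\{s>0 : E \text{ is of } \mathcal H^s\text{-measure zero}\}$ (equivalently, its Hausdorff dimension under any smooth embedding of $M$ in a Euclidean space). *)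

(* Defs.v *)
From mathcomp Require Import all_boot all_order all_algebra.
From mathcomp Require Import all_classical all_reals all_analysis.

Set Implicit Arguments.
Unset Strict Implicit.
Unset Printing Implicit Defensive.

Import Order.TTheory GRing.Theory Num.Theory.
Import numFieldNormedType.Exports.

Local Open Scope classical_set_scope.
Local Open Scope ring_scope.

(** Maps of class [C^k] on an open set [D]; only meaningful for [D] open, since
    differentiability is that of the total function [f] at the points of [D]. *)
Fixpoint Ck (R : realType) (U V : normedModType R) (k : nat) (D : set U)
    (f : U -> V) : Prop :=
  match k with
  | 0 => {in D, continuous f}
  | k'.+1 => {in D, forall x, differentiable f x} /\
             (forall v : U, Ck k' D ('D_v f))
  end.

Definition Cinfty (R : realType) (U V : normedModType R) (D : set U)
    (f : U -> V) : Prop :=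
  forall k, Ck k D f.

(** A chart is a homeomorphism from an open subset of [M] onto an open subset of
    [R^m]; the values of [chart_map] outside [chart_dom], and of [chart_inv]
    outside [chart_map @` chart_dom], are irrelevant. *)
Record chart (R : realType) (m : nat) (M : topologicalType) := Chart {
  chart_dom : set M ;
  chart_map :> M -> 'rV[R]_m ;
  chart_inv : 'rV[R]_m -> M ;
  chart_dom_open : open chart_dom ;
  chart_cod_open : open (chart_map @` chart_dom) ;
  chart_mapK : {in chart_dom, cancel chart_map chart_inv} ;
  chart_map_continuous : {in chart_dom, continuous chart_map} ;
  chart_inv_continuous : {in chart_map @` chart_dom, continuous chart_inv}
}.

Definition transition (R : realType) (m : nat) (M : topologicalType)
    (c c' : chart R m M) : 'rV[R]_m -> 'rV[R]_m :=
  c' \o chart_inv c.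

Definition smoothly_compatible (R : realType) (m : nat) (M : topologicalType)
    (c c' : chart R m M) : Prop :=
  Cinfty (c @` (chart_dom c `&` chart_dom c')) (transition c c') /\
  Cinfty (c' @` (chart_dom c `&` chart_dom c')) (transition c' c).

(** Smooth [m]-manifolds without boundary. The smooth structure is a maximal
    atlas, so that [atlas] consists of all the coordinate charts. *)
Record manifold (R : realType) (m : nat) := Manifold {
  manifold_sort :> topologicalType ;
  manifold_hausdorff : hausdorff_space manifold_sort ;
  manifold_second_countable : @second_countable manifold_sort ;
  atlas : set (chart R m manifold_sort) ;
  atlas_cover : forall p : manifold_sort,
    exists c, atlas c /\ chart_dom c p ;
  atlas_compatible : forall c c',
    atlas c -> atlas c' -> smoothly_compatible c c' ;
  atlas_maximal : forall c,
    (forall c', atlas c' -> smoothly_compatible c c') -> atlas c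
}.

Definition in_charts (R : realType) (m n : nat) (M : manifold R m)
    (N : manifold R n) (c : chart R m M) (c' : chart R n N) (f : M -> N) :
    'rV[R]_m -> 'rV[R]_n :=
  c' \o f \o chart_inv c.

Definition C1_map (R : realType) (m n : nat) (M : manifold R m)
    (N : manifold R n) (f : M -> N) : Prop :=
  continuous f /\
  forall c c', atlas c -> atlas c' ->
    Ck 1 (c @` (chart_dom c `&` f @^-1` chart_dom c')) (in_charts c c' f).

Definition chart_at (R : realType) (m : nat) (M : manifold R m) (p : M) : Type :=
  {c : chart R m M | atlas c /\ chart_dom c p}.

Definition some_chart_at (R : realType) (m : nat) (M : manifold R m) (p : M) :
    chart_at p :=
  cid (atlas_cover p).

(** A tangent vector at [p] is the family of its coordinate vectors in all the
    charts around [p], related by the differentials of the transition maps. *)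
Definition tangent_space (R : realType) (m : nat) (M : manifold R m) (p : M) :
    set (chart_at p -> 'rV[R]_m) :=
  [set v | forall c c' : chart_at p,
     v c' = 'd (transition (sval c) (sval c')) (sval c p) (v c)].

Arguments tangent_space {R m M} p.

(** When [f] is [C^1], the chain rule shows that on [tangent_space p] this does
    not depend on the chart chosen around [p], and that it takes its values in
    [tangent_space (f p)]. *)
Definition differential (R : realType) (m n : nat) (M : manifold R m)
    (N : manifold R n) (f : M -> N) (p : M) (v : chart_at p -> 'rV[R]_m) :
    chart_at (f p) -> 'rV[R]_n :=
  fun c' => let c := some_chart_at p in
    'd (in_charts (sval c) (sval c') f) (sval c p) (v c).

Arguments differential {R m n M N} f p v.

Definition critical_point (R : realType) (m n : nat) (M : manifold R m)
    (N : manifold R n) (f : M -> N) (p : M) : Prop :=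
  ~ set_surj (tangent_space p) (tangent_space (f p)) (differential f p).

(** The norm of ['rV[R]_m] in the library is the sup norm. *)
Definition euclidean_dist (R : realType) (m : nat) (x y : 'rV[R]_m) : R :=
  Num.sqrt (\sum_(i < m) (x 0 i - y 0 i) ^+ 2).

(** The point [0] makes the diameter of the empty set equal to [0]. *)
Definition diam (R : realType) (m : nat) (A : set 'rV[R]_m) : \bar R :=
  ereal_sup (0%E |` [set (euclidean_dist xy.1 xy.2)%:E | xy in A `*` A]).

(** [s]-dimensional Hausdorff measure for [0 < s], up to the positive
    normalisation constant that some authors include. *)
Definition hausdorff_premeasure (R : realType) (m : nat) (s delta : R)
    (E : set 'rV[R]_m) : \bar R :=
  ereal_inf [set (\sum_(0 <= i <oo) (diam (F i) `^ s))%E |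
    F in [set F : (set 'rV[R]_m)^nat |
      E `<=` \bigcup_i F i /\ forall i, (diam (F i) <= delta%:E)%E]].

Definition hausdorff_measure (R : realType) (m : nat) (s : R)
    (E : set 'rV[R]_m) : \bar R :=
  ereal_sup [set hausdorff_premeasure s delta E | delta in [set d : R | 0 < d]].

Definition Hs_null (R : realType) (m : nat) (M : manifold R m) (s : R)
    (E : set M) : Prop :=
  forall c, atlas c -> hausdorff_measure s (c @` (E `&` chart_dom c)) = 0%E.

Definition dimension (R : realType) (m : nat) (M : manifold R m) (E : set M) :
    \bar R :=
  ereal_inf [set s%:E | s in [set s : R | 0 < s /\ Hs_null s E]].

(* Main.v *)
From HB Require Import structures.
Require Import Defs.
From mathcomp Require Import all_boot all_order all_algebra.
From mathcomp Require Import all_classical all_reals all_analysis.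
From mathcomp Require Import ring lra.

Set Implicit Arguments.
Unset Strict Implicit.
Unset Printing Implicit Defensive.

Import Order.TTheory GRing.Theory Num.Theory.
Import numFieldNormedType.Exports.

Local Open Scope classical_set_scope.
Local Open Scope ring_scope.

(** Suppose that [f] has a regular point. The range [F] of [f] is compact, hence
    closed, and it is not the whole of [N]. By the open mapping property of a [C^1]
    map at a regular point ([regular_interior_range]), [F] has an interior point,
    and the points of [F] that are not interior to [F] have only critical
    preimages. As [N] is connected, the interior of [F] is not closed, so that there
    is a point [q] every neighbourhood of which meets both the interior of [F] and
    the complement of [F] ([frontier_point]).

    In a chart around [q], join a point [a] of the interior of [F] to a point [b]
    outside [F] by a segment. All the small translates of this segment go from [F] to
    its complement, so each of them contains a critical value
    ([path_meets_frontier]). Hence the projection along [b - a] of the set of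
    critical values near [q] contains a nonempty open subset of a space of dimension
    [n - 1].

    On the other hand, if the dimension of the critical set is less than [n - 1],
    this set is [H^s]-null for some [s < n - 1]. Locally Lipschitz images of null
    sets are null ([hnull_lipschitz]), so by compactness the set of critical values
    near [q] is null as well ([compact_hnull_image]), and so is its projection. But a
    cube of dimension [n - 1] is not [H^s]-null ([unit_cube_not_hnull]), a
    contradiction.

    Null sets are handled through countable covers by balls ([hnull]), with which the
    statement on cubes becomes a count of grid points. The two facts needed from
    calculus, the open mapping property and the local Lipschitz estimate, both follow
    from the strict differentiability of [C^1] maps ([C1_strict_diff]); the former
    by a contraction argument ([near_id_surj]). *)

(** * Compact sets *)

(** Induction on compact sets: if [K] did not have the property [P], the complements
    of the sets with this property would form a proper filter on [K], and [P]
    would fail on every neighbourhood of a cluster point of this filter. *)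
Lemma compact_local_property (T : topologicalType) (K : set T)
    (P : set T -> Prop) :
  P set0 -> (forall A B, A `<=` B -> P B -> P A) ->
  (forall A B, P A -> P B -> P (A `|` B)) -> compact K ->
  (forall x, K x -> exists2 U, nbhs x U & P U) -> P K.
Proof.
move=> P0 Psub PU compactK Plocal; apply: contrapT => nPK.
pose F := [set A | P (K `\` A)].
have FF : ProperFilter F.
  apply: Build_ProperFilter; first by rewrite /F /= setD0.
  split; rewrite /F /=; first by rewrite setDT.
  - by move=> A B /= PA PB; rewrite setDIr; exact: PU.
  - by move=> A B AB; apply: Psub; exact: setDS.
have FK : F K by rewrite /F /= setDv.
have [x [Kx clx]] := compactK F FF FK.
have [U xU PUU] := Plocal x Kx.
have FU : F (~` U) by rewrite /F /=; apply: Psub PUU => y [_ /contrapT].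
by have [y []] := clx _ _ FU xU.
Qed.

(** * Null sets for Hausdorff measures *)

Lemma row_norm_le (R : realType) k (v : 'rV[R]_k) (c : R) :
  0 <= c -> (forall i, `|v 0 i| <= c) -> `|v| <= c.
Proof.
move=> c0 vc; rewrite [leLHS]/Num.norm /= mx_normrE.
by apply/bigmax_leP; split => // -[i j] _ /=; rewrite (ord1 i).
Qed.

Lemma le_row_norm (R : realType) k (v : 'rV[R]_k) i : `|v 0 i| <= `|v|.
Proof.
rewrite [leRHS]/Num.norm /= mx_normrE.
by apply/bigmax_geP; right => /=; exists (0, i).
Qed.

(** The geometric weights [2^-(i+1)] distribute a total excess of at most [1]
    over a sequence of balls; this is how a strictly positive amount is added to
    every radius without spoiling the sum. *)
Lemma sum_dyadic_le1 (R : realType) K :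
  \sum_(i < K) (2^-1 ^+ i.+1 : R) <= 1.
Proof.
suff -> : \sum_(i < K) (2^-1 ^+ i.+1 : R) = 1 - 2^-1 ^+ K.
  by rewrite gerBl exprn_ge0.
elim: K => [|K IH]; first by rewrite big_ord0 expr0 subrr.
rewrite big_ord_recr /= IH exprS.
have := splitr (2^-1 ^+ K : R); set t := _ ^+ K.
move: t => t ->; rewrite !mulrDr; lra.
Qed.

(** [A] is null for the [s]-dimensional Hausdorff measure, in the equivalent form
    with open balls of the sup norm and partial sums. The radii are required to be
    positive so that the balls are open neighbourhoods of their centers, which
    makes compactness applicable to the covers. The bound [e] on the sums also
    forces the radii to be small, each of them being at most [e `^ s^-1]. *)
Definition hnull (R : realType) k (s : R) (A : set 'rV[R]_k) :=
  forall e : R, 0 < e -> exists (x : nat -> 'rV[R]_k) (r : nat -> R),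
    [/\ forall i, 0 < r i, A `<=` \bigcup_i ball (x i) (r i) &
        forall K, \sum_(i < K) r i `^ s <= e].

Lemma sup_dist_le_euclidean (R : realType) k (x y : 'rV[R]_k) :
  `|x - y| <= euclidean_dist x y.
Proof.
apply: row_norm_le => [|i]; first exact: sqrtr_ge0.
rewrite -sqrtr_sqr /euclidean_dist ler_sqrt ?sumr_ge0 // => [|j _].
  by rewrite (bigD1 i) //= !mxE lerDl sumr_ge0 // => j _; rewrite sqr_ge0.
by rewrite sqr_ge0.
Qed.

Lemma euclidean_dist_le_diam (R : realType) k (A : set 'rV[R]_k) x y :
  A x -> A y -> ((euclidean_dist x y)%:E <= diam A)%E.
Proof. by move=> Ax Ay; apply: ereal_sup_ubound; right; exists (x, y). Qed.

(** A cover of [A] by sets [F i] of diameters [d i] with [\sum_i d i `^ s] small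
    gives a cover by balls centered at points of the [F i]. The radius [r i] is
    defined by [r i `^ s = d i `^ s + e / 2 ^ (i + 2)]: it exceeds [d i] strictly,
    even when [d i = 0], and the sum grows by at most [e / 2]. *)
Lemma hausdorff_hnull (R : realType) k (s : R) (A : set 'rV[R]_k) :
  0 < s -> hausdorff_measure s A = 0%E -> hnull s A.
Proof.
move=> s0 hA e e0.
have : (hausdorff_premeasure s 1 A < (e / 2)%:E)%E.
  apply: (@le_lt_trans _ _ 0%E); last by rewrite lte_fin divr_gt0.
  rewrite -hA; apply: ereal_sup_ubound; exists 1 => //=.
move=> /ereal_inf_lt[_ [F [AF F1] <-] Fe].
have dge0 i : (0 <= diam (F i))%E by apply: ereal_sup_ubound; left.
pose d i := fine (diam (F i)).
have dE i : diam (F i) = (d i)%:E.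
  by rewrite fineK // ge0_fin_numE // (le_lt_trans (F1 i)) // ltry.
have d0 i : 0 <= d i by rewrite -lee_fin -dE.
pose c i := d i `^ s + e / 2 * 2^-1 ^+ i.+1.
have c0 i : d i `^ s < c i.
  by rewrite ltrDl mulr_gt0 ?divr_gt0 // exprn_gt0 // invr_gt0.
have cp i : 0 < c i by apply: le_lt_trans (c0 i); rewrite powR_ge0.
exists (fun i => xget 0 (F i)), (fun i => c i `^ s^-1); split.
- by move=> i; rewrite powR_gt0.
- move=> y /AF[i _ Fy]; exists i => //.
  have Fx : F i (xget 0 (F i)) by apply: xgetPex; exists y.
  rewrite -ball_normE /=; apply: le_lt_trans (sup_dist_le_euclidean _ _) _.
  apply: (@le_lt_trans _ _ (d i)).
    by rewrite -lee_fin -dE; apply: euclidean_dist_le_diam.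
  have -> : d i = (d i `^ s) `^ s^-1.
    by rewrite -powRrM divff ?gt_eqF // powRr1.
  by rewrite gt0_ltr_powR ?invr_gt0 // nnegrE ?powR_ge0 // ltW.
- move=> K; under eq_bigr do rewrite -powRrM mulVf ?gt_eqF // powRr1 ?ltW//.
  rewrite big_split /= -mulr_sumr [leRHS]splitr lerD //; last first.
    by rewrite ler_piMr ?sum_dyadic_le1 // ltW // divr_gt0.
  rewrite -lee_fin (le_trans _ (ltW Fe)) //.
  rewrite -sumEFin -(big_mkord xpredT (fun i => (d i `^ s)%:E)).
  under eq_bigr do rewrite -poweR_EFin -dE.
  by apply: nneseries_lim_ge => i _ _; rewrite poweR_ge0.
Qed.

Lemma hnull_sub (R : realType) k (s : R) (A B : set 'rV[R]_k) :
  A `<=` B -> hnull s B -> hnull s A.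
Proof.
move=> AB + e e0 => /(_ e e0)[x [r [r0 Br re]]].
by exists x, r; split => //; apply: subset_trans Br.
Qed.

Lemma hnull0 (R : realType) k (s : R) : 0 < s -> hnull s (@set0 'rV[R]_k).
Proof.
move=> s0 e e0; exists (fun=> 0), (fun i => (e * 2^-1 ^+ i.+1) `^ s^-1).
have p i : 0 < e * 2^-1 ^+ i.+1 by rewrite mulr_gt0 // exprn_gt0 // invr_gt0.
split=> // [i|K]; first by rewrite powR_gt0.
under eq_bigr do rewrite -powRrM mulVf ?gt_eqF // powRr1 ?ltW//.
by rewrite -mulr_sumr ler_piMr ?sum_dyadic_le1 // ltW.
Qed.

(** The two covers are interleaved along the even and the odd indices. *)
Lemma hnullU (R : realType) k (s : R) (A B : set 'rV[R]_k) :
  hnull s A -> hnull s B -> hnull s (A `|` B).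
Proof.
move=> nA nB e e0; have e20 : 0 < e / 2 by rewrite divr_gt0.
have [x [r [r0 Ar re]]] := nA _ e20.
have [y [t [t0 Bt te]]] := nB _ e20.
pose u i := if odd i then t i./2 else r i./2.
exists (fun i => if odd i then y i./2 else x i./2), u; rewrite /u; split.
- by move=> i; case: ifP.
- move=> z [/Ar[i _ zi]|/Bt[i _ zi]].
    by exists i.*2 => //; rewrite odd_double doubleK.
  by exists i.*2.+1 => //; rewrite /= odd_double /= uphalf_double.
- move=> K.
  pose S n : R := \sum_(i < n) u i `^ s.
  have SE : S K.*2 = \sum_(i < K) r i `^ s + \sum_(i < K) t i `^ s.
    rewrite /S; elim: K => [|K IH]; first by rewrite !big_ord0 addr0.
    rewrite doubleS !big_ord_recr /= IH /u /= odd_double /= uphalf_double doubleK.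
    by rewrite -!addrA; congr (_ + _); rewrite addrCA.
  have leS : S K <= S K.*2.
    rewrite /S -!(big_mkord xpredT (fun i => u i `^ s)) -addnn.
    rewrite [leRHS](@big_cat_nat _ _ _ K) //= ?leq_addr // lerDl sumr_ge0 // => i _.
    by rewrite powR_ge0.
  apply: le_trans leS _; rewrite SE [e]splitr; exact: lerD.
Qed.

(** The image of the part of [A] in a ball of radius [r] is in a ball of radius
    [2 * L * r] around any one of its points; the factor [2] is there because the
    center of the original ball need not belong to [A]. *)
Lemma hnull_lipschitz (R : realType) k l (s L : R) (A : set 'rV[R]_k)
    (g : 'rV[R]_k -> 'rV[R]_l) :
  0 < L -> (forall x y, A x -> A y -> `|g x - g y| <= L * `|x - y|) ->
  hnull s A -> hnull s (g @` A).
Proof.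
move=> L0 gL nA e e0.
have c0 : 0 < (2 * L) `^ s by apply: powR_gt0; rewrite mulr_gt0.
have [x [r [r0 Ar re]]] := nA _ (divr_gt0 e0 c0).
pose a i := xget 0 (A `&` ball (x i) (r i)).
exists (fun i => g (a i)), (fun i => (2 * L) * r i); split.
- by move=> i; rewrite !mulr_gt0.
- move=> _ [y Ay <-]; have [i _ yi] := Ar y Ay; exists i => //.
  have [Aa ai] : (A `&` ball (x i) (r i)) (a i) by apply: xgetPex; exists y.
  rewrite -ball_normE /=; apply: le_lt_trans (gL _ _ Aa Ay) _.
  rewrite mulrAC mulrC ltr_pM2r //.
  have -> : a i - y = (x i - y) - (x i - a i) by rewrite opprB [RHS]addrC subrKA.
  move: yi ai; rewrite -ball_normE /= => yi ai.
  by rewrite (le_lt_trans (ler_normB _ _)) // mulr_natl mulr2n ltrD.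
- move=> K; under eq_bigr do rewrite powRM ?mulr_ge0 ?ltW //.
  by rewrite -mulr_sumr mulrC -ler_pdivlMr.
Qed.

(** * Cubes are not null *)

(** Two grid points of an open interval of length [2 * r] differ by less than
    [2 * r], so that the smallest index and the largest one bound the count. *)
Lemma card_grid_interval (R : realType) N (c r : R) :
  0 < r ->
  (#|[set t : 'I_N.+1 | `|c - t%:R / N.+1%:R| < r]%SET|%:R : R)
    <= 2 * (N.+1%:R * r) + 1.
Proof.
move=> r0; set S := finset _.
have N0 : 0 < N.+1%:R :> R by [].
have [->|[t0 St0]] := set_0Vmem S.
  by rewrite cards0 addr_ge0 // !mulr_ge0 // ltW.
pose a := [arg min_(t < t0 in S) (t : nat)].
pose b := [arg max_(t > t0 in S) (t : nat)].
have [Sa amin] : a \in S /\ forall t, t \in S -> (a <= t)%N.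
  by rewrite /a; case: arg_minnP.
have [Sb bmax] : b \in S /\ forall t, t \in S -> (t <= b)%N.
  by rewrite /b; case: arg_maxnP.
have Sab : (#|S| <= (b - a).+1)%N.
  rewrite -[X in (_ <= X)%N]card_ord.
  rewrite -(@card_in_imset _ _ (fun t : 'I_N.+1 => inord (t - a) : 'I_(b - a).+1)).
    exact: max_card.
  move=> t u St Su /(congr1 val) /=; rewrite !inordK ?ltnS ?leq_sub2r ?bmax //.
  move=> tu; apply: ord_inj.
  by rewrite -(subnK (amin _ St)) tu subnK // amin.
have dba : b%:R - a%:R <= 2 * (N.+1%:R * r) :> R.
  move: Sa Sb; rewrite !inE => Sa Sb.
  rewrite mulrCA -ler_pdivrMl // mulrBr ![_^-1 * _]mulrC.
  apply: (le_trans (ler_norm _)).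
  have -> : b%:R / N.+1%:R - a%:R / N.+1%:R
    = (c - a%:R / N.+1%:R) - (c - b%:R / N.+1%:R) :> R.
    by rewrite opprB [RHS]addrC subrKA.
  by rewrite (le_trans (ler_normB _ _)) // [2 * r]mulr_natl mulr2n lerD // ltW.
rewrite (@le_trans _ _ (b - a).+1%:R) ?ler_nat // -natr1 natrB ?amin //.
by rewrite lerD2r.
Qed.

Lemma card_grid_ball (R : realType) k N (x : 'rV[R]_k) (r : R) :
  0 < r ->
  (#|[set g : {ffun 'I_k -> 'I_N.+1} |
       [forall j, `|x 0 j - (g j)%:R / N.+1%:R| < r]]%SET|%:R : R)
    <= (2 * (N.+1%:R * r) + 1) ^+ k.
Proof.
move=> r0.
pose S j := [set t : 'I_N.+1 | `|x 0 j - t%:R / N.+1%:R| < r]%SET.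
rewrite (_ : #|_| = #|family (fun j => mem (S j))|)%N; last first.
  apply: eq_card => g; rewrite inE; apply/forallP/familyP => gS j.
    by have := gS j; rewrite inE.
  by have := gS j; rewrite inE.
rewrite card_family foldrE big_map enumT natr_prod.
rewrite -[X in _ ^+ X](card_ord k) -prodr_const.
apply: ler_prod => j _; rewrite ler0n /=; exact: card_grid_interval.
Qed.

Lemma compact_unit_cube (R : realType) k :
  compact [set x : 'rV[R]_k | forall j, x 0 j \in `[0, 1]].
Proof.
have := @rV_compact R k (fun=> `[0, 1]%classic) (fun=> @segment_compact R 0 1).
by congr compact; apply/seteqP; split=> x /= xI j; have := xI j; rewrite (ord1 0).
Qed.

(** Counting the points of a fine grid plays the part of the Lebesgue measure. By
    compactness, finitely many balls of a small cover suffice. Among the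
    [(N + 1) ^ k] points of a fine grid, a ball of radius [r] contains at most
    [(3 * (N + 1) * r) ^ k], so that [1 <= 3 ^ k * \sum_i r i ^ k]; as
    [r i <= 1] and [s <= k], the sum is at most [\sum_i r i `^ s], which can be
    chosen smaller than [3 ^- k]. *)
Lemma unit_cube_not_hnull (R : realType) k (s : R) :
  0 < s -> s <= k%:R ->
  ~ hnull s [set x : 'rV[R]_k | forall j, x 0 j \in `[0, 1]].
Proof.
move=> s0 sk /(_ ((3 ^+ k)^-1 / 2)).
have e3 : 0 < (3 ^+ k : R)^-1 by rewrite invr_gt0 exprn_gt0.
have e31 : (3 ^+ k : R)^-1 <= 1 by rewrite invf_le1 ?exprn_gt0 // exprn_ege1 // ler1n.
case; first by rewrite divr_gt0.
move=> x [r [r0 cover_r sum_r]].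
have [K coverK] : exists K, [set x : 'rV[R]_k | forall j, x 0 j \in `[0, 1]]
    `<=` \bigcup_(i < K) ball (x i) (r i).
  pose P A := exists K, A `<=` \bigcup_(i < K) ball (x i) (r i).
  apply: (@compact_local_property _ _ P _ _ _ (@compact_unit_cube R k))
    => [|A B AB [K BK]|A B [K AK] [L BL]|y cube_y].
  - by exists 0%N.
  - by exists K; exact: subset_trans BK.
  - by exists (maxn K L) => y [/AK|/BL][i /= iK yi]; exists i => //=;
      rewrite leq_max iK ?orbT.
  - have [i _ yi] := cover_r y cube_y; exists (ball (x i) (r i)).
      by apply: open_nbhs_nbhs; split => //; exact: ball_open.
    by exists i.+1 => z zi; exists i => //=.
have r1 i : r i <= 1.
  rewrite leNgt; apply/negP => r1.
  have := sum_r i.+1; rewrite big_ord_recr /= leNgt => /negP; apply.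
  apply: (@lt_le_trans _ _ (r i `^ s)); last first.
    by rewrite lerDr sumr_ge0 // => j _; rewrite powR_ge0.
  apply: (@le_lt_trans _ _ (1 `^ s)).
    by rewrite powR1 ler_pdivrMr // mul1r (le_trans e31) // ler1n.
  by rewrite gt0_ltr_powR // nnegrE ltW.
(* A grid so fine that its mesh is at most each of the finitely many radii. *)
pose N := Num.truncn (\sum_(i < K) (r i)^-1).
have N1 i : (i < K)%N -> 1 <= N.+1%:R * r i.
  move=> iK; rewrite -ler_pdivrMr // mul1r.
  apply: le_trans (ltW (truncnS_gt _)).
  rewrite (bigD1 (Ordinal iK)) //= lerDl sumr_ge0 // => j _.
  by rewrite invr_ge0 ltW.
pose G i := [set g : {ffun 'I_k -> 'I_N.+1} |
       [forall j, `|x i 0 j - (g j)%:R / N.+1%:R| < r i]]%SET.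
have GT : (#|{ffun 'I_k -> 'I_N.+1}| <= \sum_(i < K) #|G i|)%N.
  under eq_bigr do rewrite -sum1_card big_mkcond.
  rewrite exchange_big -sum1_card; apply: leq_sum => g _.
  have /coverK[i /= iK] : [set x : 'rV[R]_k | forall j, x 0 j \in `[0, 1]]
      (\row_j ((g j)%:R / N.+1%:R)).
    move=> j; rewrite mxE in_itv /= divr_ge0 //= ler_pdivrMr // mul1r ler_nat.
    exact: ltnW.
  rewrite -ball_normE /= => gi.
  rewrite (bigD1 (Ordinal iK)) //= inE ifT ?leq_addr //.
  apply/forallP => j; apply: le_lt_trans gi.
  by apply: le_trans (le_row_norm _ j); rewrite !mxE.
have : (N.+1%:R ^+ k : R) <= N.+1%:R ^+ k * (3 ^+ k * ((3 ^+ k)^-1 / 2)).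
  rewrite -[leLHS]natrX; move: GT; rewrite card_ffun !card_ord.
  rewrite -(ler_nat R) natr_sum => /le_trans; apply.
  apply: (@le_trans _ _ (\sum_(i < K) N.+1%:R ^+ k * 3 ^+ k * (r i `^ s))).
    apply: ler_sum => i _; apply: le_trans (card_grid_ball _ _ (r0 i)) _.
    apply: (@le_trans _ _ ((N.+1%:R * 3 * r i) ^+ k)).
      have := N1 i (ltn_ord i); move: N.+1%:R (r i) => a b ab.
      by apply: lerXn2r; rewrite ?nnegrE; lra.
    rewrite !exprMn ler_wpM2l ?mulr_ge0 ?exprn_ge0 //.
    by rewrite -(powR_mulrn _ (ltW (r0 i))) ger_powR // r0 r1.
  rewrite -mulr_sumr -mulrA ler_wpM2l ?exprn_ge0 // ler_wpM2l ?exprn_ge0 //.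
rewrite [3 ^+ k * _]mulrA divff ?gt_eqF ?exprn_gt0 // mul1r ler_pMr ?exprn_gt0 //; lra.
Qed.

(** * Strict differentiability of maps of class C^1 *)

Lemma ball_convex (R : realType) (V : normedModType R) (x y z : V) (d t : R) :
  ball x d y -> ball x d z -> 0 <= t <= 1 -> ball x d (z + t *: (y - z)).
Proof.
rewrite -ball_normE /= => xy xz /andP[t0 t1].
have -> : x - (z + t *: (y - z)) = (1 - t) *: (x - z) + t *: (x - y).
  rewrite scalerBl scale1r -[RHS]addrA [- _ + _]addrC -scalerBr.
  have -> : x - y - (x - z) = - (y - z) by rewrite !opprB addrC subrKA.
  by rewrite scalerN opprD addrA.
apply: (@le_lt_trans _ _ (Num.max `|x - y| `|x - z|)); last by rewrite gt_max xy.
apply: le_trans (ler_normD _ _) _; rewrite !normrZ !ger0_norm ?subr_ge0 //.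
set M := Num.max _ _.
have M1 : `|x - y| <= M by rewrite le_max lexx.
have M2 : `|x - z| <= M by rewrite le_max lexx orbT.
have -> : M = (1 - t) * M + t * M by rewrite mulrBl mul1r subrK.
by rewrite lerD // ler_wpM2l // subr_ge0.
Qed.

Lemma linear_rowE (R : realType) m n (f : {linear 'rV[R]_m -> 'rV[R]_n}) v :
  f v = \sum_i v 0 i *: f (delta_mx 0 i).
Proof.
by rewrite {1}(row_sum_delta v) linear_sum; apply: eq_bigr => i _; rewrite linearZ.
Qed.

(** A [C^1] map is strictly differentiable. On a ball where every partial derivative
    is close to its value at [x], the mean value theorem is applied to each
    coordinate of [g] along the segment from [z] to [y]; the difference of the two
    differentials is then a sum of [m] terms, one for each partial derivative. *)
Lemma C1_strict_diff (R : realType) m n (D : set 'rV[R]_m)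
    (g : 'rV[R]_m -> 'rV[R]_n) (x : 'rV[R]_m) (e : R) :
  open D -> D x -> Ck 1 D g -> 0 < e ->
  exists d, [/\ 0 < d, ball x d `<=` D & forall y z, ball x d y -> ball x d z ->
    `|g y - g z - 'd g x (y - z)| <= e * `|y - z|].
Proof.
move=> oD Dx [dg cg] e0.
have m0 : 0 < m%:R + 1 :> R by rewrite ltr_wpDl.
have em0 : 0 < e / (m%:R + 1) by rewrite divr_gt0.
have near_partial : \forall y \near x, forall i : 'I_m,
    `|'D_(delta_mx 0 i) g x - 'D_(delta_mx 0 i) g y| < e / (m%:R + 1).
  suff P i : \forall y \near x,
      `|'D_(delta_mx 0 i) g x - 'D_(delta_mx 0 i) g y| < e / (m%:R + 1).
    exact: (@filter_forall _ _ _ (nbhs x) _ P).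
  have := cg (delta_mx 0 i) x (mem_set Dx).
  by move/cvgrPdist_lt; apply.
have near_D : \forall y \near x, D y by exact: open_nbhs_nbhs.
have [d /= d0 dP] := (nbhs_ballP _ _).1 (filterI near_D near_partial).
exists d; split=> // [y /dP[]//|y z xy xz].
have ec0 : 0 <= e * `|y - z| by rewrite mulr_ge0 // ltW.
apply: row_norm_le => // j.
(* The [j]-th coordinate of [g] along the segment from [z] to [y]. *)
pose p (t : R) := z + t *: (y - z).
pose phi (t : R) := g (p t) 0 j.
have pball (t : R) : 0 <= t <= 1 -> ball x d (p t) by exact: ball_convex.
have dp (t : R) : 0 <= t <= 1 -> is_derive t (1 : R) phi ('d g (p t) (y - z) 0 j).
  move=> t01; have dgp : differentiable g (p t).
    by have [Dp _] := dP _ (pball t t01); exact: (dg _ (mem_set Dp)).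
  have dgpt : is_diff t (g \o p) ('d g (p t) \o ( *:%R ^~ (y - z))).
    apply: is_diff_comp; last exact: DiffDef.
    have -> : p = cst z + ( *:%R ^~ (y - z)) by [].
    apply: (is_diff_eq (is_diffD (is_diff_cst z t) (is_diff_scalel t (y - z)))).
    by rewrite add0r.
  have dgp1 : derivable (g \o p) t 1 by apply/derivable1_diffP; case: dgpt.
  apply: DeriveDef; first exact: (derivable_mxP _ _ _).1.
  have := deriveE (1 : R) (ex_diff (is_diff_def := dgpt)).
  rewrite (derive_mx dgp1).
  by rewrite (diff_val (is_diff_def := dgpt)) /= scale1r => /rowP/(_ j); rewrite !mxE.
have [c c01] : exists2 c, c \in `[0, 1]%R & phi 1 - phi 0 =
    'd g (p c) (y - z) 0 j * (1 - 0).
  apply: MVT_segment => // [t t01|].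
    by apply: dp; rewrite !(itvP t01).
  apply: derivable_within_continuous => t t01.
  by apply: ex_derive; apply: dp; rewrite !(itvP t01).
rewrite subr0 mulr1 /phi /p scale1r scale0r addr0 (addrC z) subrK => phiE.
have subE (u v : 'rV[R]_n) : (u - v) 0 j = u 0 j - v 0 j by rewrite !mxE.
have scaleE a (u : 'rV[R]_n) : (a *: u) 0 j = a * u 0 j by rewrite mxE.
rewrite !subE phiE.
have partial_close i : `|'d g (p c) (delta_mx 0 i) 0 j - 'd g x (delta_mx 0 i) 0 j|
    <= e / (m%:R + 1).
  have [|Dp /(_ i)] := dP (p c); first by apply: pball; rewrite !(itvP c01).
  rewrite distrC (deriveE _ (dg _ (mem_set Dp))) (deriveE _ (dg _ (mem_set Dx))).
  move/ltW; apply: le_trans.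
  by rewrite -subE le_row_norm.
have rowE := @linear_rowE R m n.
move: ('d g (p c)) ('d g x) partial_close => A B partial_close.
rewrite (rowE A) (rowE B) !summxE -sumrB.
apply: (@le_trans _ _ (\sum_(i < m) `|y - z| * (e / (m%:R + 1)))).
  apply: (le_trans (ler_norm_sum _ _ _)); apply: ler_sum => i _.
  rewrite !scaleE -mulrBr normrM.
  by rewrite ler_pM // le_row_norm.
rewrite sumr_const card_ord -mulrnAr [leRHS]mulrC ler_wpM2l // -mulr_natr.
by rewrite mulrAC ler_pdivrMr // ler_pM2l // lerDl.
Qed.

(** * Openness at regular points and local Lipschitz estimates *)

(** The fixed point theorem asks for the join of the norm and the completeness of
    the space of matrices. *)
HB.instance Definition _ (R : realType) (m n : nat) :=
  Uniform_isComplete.Build 'M[R]_(m, n) (@cauchy_cvg 'M[R]_(m, n)).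

(** A map [1/2]-close to the identity takes every value near [h 0]: the solutions of
    [h z = y] are the fixed points of [z |-> z - h z + y], a contraction of the
    closed ball of radius [d]. *)
Lemma near_id_surj (R : realType) (X : completeNormedModType R) (h : X -> X)
    (d : R) (y : X) :
  0 < d ->
  (forall z z', `|z| <= d -> `|z'| <= d ->
    `|h z - h z' - (z - z')| <= 2^-1 * `|z - z'|) ->
  `|y - h 0| <= 2^-1 * d ->
  exists2 z, `|z| <= d & h z = y.
Proof.
move=> d0 hid hy.
pose U := [set z : X | `|z| <= d].
pose T z := z - h z + y.
have TU : set_fun U U T.
  move=> z; rewrite /U /T /= => zd.
  have -> : z - h z + y = (y - h 0) - (h z - h 0 - (z - 0)).
    by rewrite subr0 !opprB addrCA subrKA -addrA [- _ + _]addrC.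
  apply: (le_trans (ler_normB _ _)); rewrite [d]splitr [d / 2]mulrC lerD //.
  apply: (le_trans (hid _ _ _ _)); rewrite ?normr0 ?(ltW d0) // subr0.
  by rewrite ler_wpM2l // invr_ge0.
have := @banach_fixed_point R X U (mkfun TU).
case.
- exists (2^-1)%:nng; split => /=; first by rewrite invf_lt1 // ltr1n.
  move=> [z z'] /= [Uz Uz'].
  have -> : T z - T z' = - (h z - h z' - (z - z')).
    rewrite /T !opprB opprD addrACA subrr addr0 opprB.
    by rewrite addrACA [RHS]addrACA [- h z - z']addrC.
  by rewrite normrN hid.
- rewrite (_ : U = closed_ball 0 d); first exact: closed_ball_closed.
  by rewrite closed_ballE //; apply/seteqP; split=> z;
    rewrite /U /closed_ball_ /= sub0r normrN.
- by exists 0; rewrite /U /= normr0 ltW.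
- move=> z Uz zT; exists z => //.
  have : z = y - h z + z by rewrite -addrA [- _ + _]addrC [RHS]addrC; exact: zT.
  by move/eqP; rewrite -subr_eq subrr eq_sym subr_eq0 => /eqP.
Qed.

(** Open mapping at a regular point. Composing [g] with a linear right inverse [S] of
    its differential gives a map close to the identity in the sense of
    [near_id_surj], because of the strict differentiability of [g]. *)
Lemma C1_open_map (R : realType) m n (D : set 'rV[R]_m)
    (g : 'rV[R]_m -> 'rV[R]_n) (x : 'rV[R]_m) :
  open D -> D x -> Ck 1 D g -> (forall w, exists v, 'd g x v = w) ->
  nbhs (g x) (g @` D).
Proof.
move=> oD Dx gC1 surj.
have /choice[v vE] : forall i : 'I_n, exists v, 'd g x v = delta_mx 0 i.
  by move=> i; exact: surj.
pose L := 1 + \sum_i `|v i|.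
have L0 : 0 < L by rewrite ltr_wpDr // sumr_ge0.
(* [S] maps the canonical basis to preimages of it, hence [dS] below. *)
pose S (w : 'rV[R]_n) := \sum_i w 0 i *: v i.
have SB w w' : S w - S w' = S (w - w').
  by rewrite /S -sumrB; apply: eq_bigr => i _; rewrite -scalerBl !mxE.
have Sle w : `|S w| <= L * `|w|.
  apply: (le_trans (ler_norm_sum _ _ _)).
  rewrite mulrDl mul1r ler_wpDl // mulr_suml; apply: ler_sum => i _.
  by rewrite normrZ mulrC ler_wpM2l // le_row_norm.
have dS w : 'd g x (S w) = w.
  rewrite /S [RHS]row_sum_delta; move: ('d g x) vE => A vE.
  by rewrite linear_sum; apply: eq_bigr => i _; rewrite linearZ /= vE.
have S0 : S 0 = 0 by rewrite /S big1 // => i _; rewrite mxE scale0r.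
have e0 : 0 < (2 * L)^-1 by rewrite invr_gt0 mulr_gt0.
have [d [d0 dD gd]] := C1_strict_diff oD Dx gC1 e0.
have r0 : 0 < d * (2 * L)^-1 by rewrite mulr_gt0.
pose r := d * (2 * L)^-1.
have Sball w : `|w| <= r -> ball x d (x + S w).
  move=> wr; rewrite -ball_normE /= opprD addrA subrr add0r normrN.
  apply: le_lt_trans (Sle w) _.
  apply: (@le_lt_trans _ _ (L * r)); first by rewrite ler_wpM2l // ltW.
  have -> : L * r = d / 2 by rewrite /r; field; rewrite gt_eqF.
  by rewrite ltr_pdivrMr // ltr_pMr // ltr1n.
apply/nbhs_ballP; exists (2^-1 * r); first by rewrite /= mulr_gt0 // invr_gt0.
move=> y; rewrite -ball_normE /= distrC => gy.
have [||z zr <-] := @near_id_surj R _ (fun w => g (x + S w)) r y r0.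
- move=> z z' zr z'r.
  have := gd _ _ (Sball z zr) (Sball z' z'r).
  have -> : x + S z - (x + S z') = S (z - z').
    by rewrite opprD addrACA subrr add0r SB.
  rewrite dS.
  move/le_trans; apply; apply: le_trans (ler_wpM2l (ltW e0) (Sle _)) _.
  by rewrite invfM -mulrA mulKf // gt_eqF.
- by rewrite S0 addr0 ltW.
- by exists (x + S z) => //; apply: dD; exact: Sball.
Qed.

Lemma C1_locally_lipschitz (R : realType) m n (D : set 'rV[R]_m)
    (g : 'rV[R]_m -> 'rV[R]_n) (x : 'rV[R]_m) :
  open D -> D x -> Ck 1 D g ->
  exists d L, [/\ 0 < d, 0 < L, ball x d `<=` D &
    forall y z, ball x d y -> ball x d z -> `|g y - g z| <= L * `|y - z|].
Proof.
move=> oD Dx gC1.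
have [d [d0 dD gd]] := C1_strict_diff oD Dx gC1 ltr01.
have [K K0 KP] := linear_lipschitz (diff_continuous (gC1.1 x (mem_set Dx))).
exists d, (1 + K); split=> // [|y z xy xz]; first by rewrite addr_gt0.
have -> : g y - g z = (g y - g z - 'd g x (y - z)) + 'd g x (y - z).
  by rewrite subrK.
by rewrite (le_trans (ler_normD _ _)) // mulrDl lerD // gd.
Qed.

(** * Projections along a line and crossings of a frontier *)

(** If [B] meets every line of direction [u] near a given one, then the projection
    along [u] maps [B] onto a set that contains an open subset of the hyperplane,
    so that [B] has dimension at least [k]. The projection eliminates a coordinate
    [j] at which [u] does not vanish; it is rescaled so that the image of [B]
    contains the unit cube. *)
Lemma slab_not_hnull (R : realType) k (s rho : R) (a u : 'rV[R]_k.+1)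
    (B : set 'rV[R]_k.+1) :
  u != 0 -> 0 < rho -> 0 < s -> s <= k%:R ->
  (forall w, `|w| < rho -> exists t, B (a + w + t *: u)) ->
  ~ hnull s B.
Proof.
move=> u0 rho0 s0 sk Bu.
have [j uj] : exists j, u 0 j != 0.
  apply: contrapT => /forallNP ujs; move/eqP: u0; apply; apply/rowP => j.
  by rewrite mxE; apply/eqP/negPn/negP; exact: ujs.
(* [P] is the rescaled projection, and [lin] a section of it up to translation. *)
pose q i := u 0 (lift j i) / u 0 j.
pose P (y : 'rV[R]_k.+1) : 'rV[R]_k :=
  \row_i ((rho / 2)^-1 * (y 0 (lift j i) - a 0 (lift j i) -
                          (y 0 j - a 0 j) * q i)).
pose lin (v : 'rV[R]_k) : 'rV[R]_k.+1 :=
  \row_l (if unlift j l is Some i then rho / 2 * v 0 i else 0).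
have rho20 : 0 < rho / 2 by rewrite divr_gt0.
have Plin v t : P (a + lin v + t *: u) = v.
  apply/rowP => i; rewrite !mxE liftK unlift_none /q; field.
  by rewrite uj gt_eqF.
have lin_small (v : 'rV[R]_k) : (forall i, v 0 i \in `[0, 1]) -> `|lin v| < rho.
  move=> v01; apply: (@le_lt_trans _ _ (rho / 2)); last first.
    by rewrite ltr_pdivrMr // ltr_pMr // ltr1n.
  apply: row_norm_le => [|l]; first exact: ltW.
  rewrite mxE; case: unlift => [i|]; last by rewrite normr0 ltW.
  have := v01 i; rewrite in_itv /= => /andP[v0 v1].
  have r0 := ltW rho20.
  by rewrite normrM (ger0_norm r0) (ger0_norm v0) ler_piMr.
pose L := (rho / 2)^-1 * (1 + `|u| / `|u 0 j|).
have L0 : 0 < L.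
  by rewrite mulr_gt0 ?invr_gt0 // ltr_wpDr // divr_ge0.
have Plip x y : `|P x - P y| <= L * `|x - y|.
  apply: row_norm_le => [|i]; first by rewrite mulr_ge0 // ltW.
  have -> : (P x - P y) 0 i =
      (rho / 2)^-1 * ((x - y) 0 (lift j i) - (x - y) 0 j * q i).
    by rewrite !mxE; ring.
  rewrite normrM gtr0_norm ?invr_gt0 // /L -mulrA ler_wpM2l ?invr_ge0 ?(ltW rho20) //.
  apply: (le_trans (ler_normB _ _)); rewrite mulrDl mul1r lerD ?le_row_norm //.
  rewrite normrM mulrC ler_pM ?le_row_norm //.
  by rewrite /q normrM normfV ler_wpM2r ?invr_ge0 ?le_row_norm.
move=> nB; apply: (unit_cube_not_hnull s0 sk).
apply: (hnull_sub _ (hnull_lipschitz L0 (fun x y _ _ => Plip x y) nB)).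
by move=> v /= v01; have [t Bt] := Bu _ (lin_small v v01); exists (a + lin v + t *: u).
Qed.

(** Otherwise the set of times [t] with [F (phi t)] would be open and closed in the
    unit interval. *)
Lemma path_meets_frontier (R : realType) (T : topologicalType) (F : set T)
    (phi : R -> T) :
  closed F -> (forall t, 0 <= t <= 1 -> {for t, continuous phi}) ->
  F (phi 0) -> ~ F (phi 1) ->
  exists t, [/\ 0 <= t <= 1, F (phi t) & ~ nbhs (phi t) F].
Proof.
move=> cF phic F0 F1; apply: contrapT => noex.
have inF t : 0 <= t <= 1 -> F (phi t) -> nbhs (phi t) F.
  by move=> t01 Ft; apply: contrapT => nF; apply: noex; exists t.
pose B := `[0, 1]%classic `&` phi @^-1` F.
have B01 : B = `[0, 1]%classic :> set R.
  have := @segment_connected R 0 1; apply.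
  - by exists 0; split => //=; rewrite in_itv /= lexx ler01.
  - exists (interior (phi @^-1` F)); first exact: open_interior.
    apply/seteqP; split=> t [t01 Ft]; split=> //; last exact: interior_subset Ft.
    have t01' : 0 <= t <= 1 by rewrite /= in_itv in t01.
    exact: phic t t01' _ (inF t t01' Ft).
  - exists (closure (phi @^-1` F)); first exact: closed_closure.
    apply/seteqP; split=> t [t01 Ft]; split=> //; first exact: subset_closure.
    have t01' : 0 <= t <= 1 by rewrite /= in_itv in t01.
    apply: cF => V /(phic t t01') Vt; have [z [Fz Vz]] := Ft _ Vt.
    by exists (phi z).
have : B 1 by rewrite B01 /= in_itv /= ler01 lexx.
by case.
Qed.

(** * Charts, tangent spaces and regular points *)

Lemma near_eq_diff (R : realType) (U V : normedModType R) (f g : U -> V) x :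
  {near x, f =1 g} -> differentiable f x -> differentiable g x ->
  'd f x = 'd g x :> (U -> V).
Proof.
move=> fg df dg; apply/funext => v.
by rewrite -(deriveE v df) -(deriveE v dg); exact: near_eq_derive.
Qed.

Lemma diff_comp_near (R : realType) (U V W : normedModType R) (f : U -> V)
    (g : V -> W) (h : U -> W) x y v :
  f x = y -> differentiable f x -> differentiable g y -> differentiable h x ->
  {near x, g \o f =1 h} -> 'd g y ('d f x v) = 'd h x v.
Proof.
move=> <- df dg dh gfh.
rewrite -(near_eq_diff gfh (differentiable_comp df dg) dh).
by have /(congr1 (@^~ v)) := diff_comp df dg.
Qed.

Section Charts.
Variables (R : realType) (m : nat) (M : topologicalType) (c : chart R m M).

Lemma chartK p : chart_dom c p -> chart_inv c (c p) = p.
Proof. by move=> cp; apply: chart_mapK; exact: mem_set. Qed.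

Lemma chart_inv_dom y : (c @` chart_dom c) y -> chart_dom c (chart_inv c y).
Proof. by move=> [p cp <-]; rewrite chartK. Qed.

Lemma chart_invK y : (c @` chart_dom c) y -> c (chart_inv c y) = y.
Proof. by move=> [p cp <-]; rewrite chartK. Qed.

Lemma nbhs_chart_inv p U : chart_dom c p -> nbhs p U ->
  \forall y \near c p, chart_dom c (chart_inv c y) /\ U (chart_inv c y) /\
    c (chart_inv c y) = y.
Proof.
move=> cp pU.
have cpD : (c @` chart_dom c) (c p) by exists p.
have inv_p : chart_inv c (c p) = p by rewrite chartK.
have near_cod : \forall y \near c p, (c @` chart_dom c) y.
  by apply: open_nbhs_nbhs; split => //; exact: chart_cod_open.
have near_U : \forall y \near c p, U (chart_inv c y).
  have := @chart_inv_continuous _ _ _ c (c p) (mem_set cpD) U.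
  by rewrite inv_p; apply.
near=> y; split; last split.
- by apply: chart_inv_dom; near: y.
- by near: y.
- by apply: chart_invK; near: y.
Unshelve. all: by end_near. Qed.

Lemma chart_image_open U : open U -> open (c @` (chart_dom c `&` U)).
Proof.
move=> oU; rewrite openE => _ [p [cp Up] <-].
rewrite /interior; have nU : nbhs p U by exact: open_nbhs_nbhs.
apply: filterS (nbhs_chart_inv cp nU) => y [dy [Uy yE]].
by exists (chart_inv c y).
Qed.

Lemma chart_inj p q : chart_dom c p -> chart_dom c q -> c p = c q -> p = q.
Proof.
by move=> cp cq pq; rewrite -(chartK cp) pq chartK.
Qed.
End Charts.

Section TangentSpace.
Variables (R : realType) (m : nat) (M : manifold R m).

Lemma transition_at (c c' : chart R m M) p :
  chart_dom c p -> transition c c' (c p) = c' p.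
Proof. by move=> cp; rewrite /transition /= chartK. Qed.

Lemma transition_differentiable (c c' : chart R m M) p :
  atlas c -> atlas c' -> chart_dom c p -> chart_dom c' p ->
  differentiable (transition c c') (c p).
Proof.
move=> ac ac' cp c'p; have [+ _] := atlas_compatible ac ac'.
by move=> /(_ 1%N)[+ _]; apply; apply: mem_set; exists p.
Qed.

(** Chain rule for the transition maps: [transition c1 c2 \o transition c0 c1] and
    [transition c0 c2] agree only near [c0 p], which is all the differential
    sees. *)
Lemma diff_transition_comp (c0 c1 c2 : chart R m M) p v :
  atlas c0 -> atlas c1 -> atlas c2 ->
  chart_dom c0 p -> chart_dom c1 p -> chart_dom c2 p ->
  'd (transition c1 c2) (c1 p) ('d (transition c0 c1) (c0 p) v) =
  'd (transition c0 c2) (c0 p) v.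
Proof.
move=> a0 a1 a2 p0 p1 p2.
apply: diff_comp_near; first exact: transition_at.
- exact: transition_differentiable.
- exact: transition_differentiable.
- exact: transition_differentiable.
have n1 : nbhs p (chart_dom c1).
  by apply: open_nbhs_nbhs; split => //; exact: chart_dom_open.
apply: filterS (nbhs_chart_inv p0 n1) => y [_ [y1 _]].
by rewrite /transition /= chartK.
Qed.

Lemma diff_transition_id (c : chart R m M) p v :
  atlas c -> chart_dom c p -> 'd (transition c c) (c p) v = v.
Proof.
move=> ac cp; have dc := transition_differentiable ac ac cp cp.
have near_id : {near c p, transition c c =1 id}.
  by apply: filterS (nbhs_chart_inv cp filterT) => y [_ [_]].
have did := is_diff_id (c p).
by rewrite (near_eq_diff near_id dc (ex_diff (is_diff_def := did))) diff_val.
Qed.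

(** A tangent vector can be prescribed by its coordinates in one chart: the transition
    maps determine the others, consistently by the chain rule. *)
Lemma tangent_vector_exists (p : M) (c : chart_at p) (w : 'rV[R]_m) :
  exists2 v, tangent_space p v & v c = w.
Proof.
exists (fun c' => 'd (transition (sval c) (sval c')) (sval c p) w).
  move=> [c1 [a1 p1]] [c2 [a2 p2]] /=; case: c => [c [ac pc]] /=.
  exact/esym/diff_transition_comp.
by case: c => [c [ac pc]]; exact: diff_transition_id.
Qed.
End TangentSpace.

Section C1Maps.
Variables (R : realType) (m n : nat) (M : manifold R m) (N : manifold R n).
Variables (f : M -> N) (C1f : C1_map f).

(** Surjectivity of the differential on tangent spaces gives surjectivity in
    coordinates because every coordinate vector [w] at [f p] extends to a tangent
    vector. *)
Lemma regular_diff_surj p : ~ critical_point f p ->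
  exists c c', [/\ atlas c, atlas c', chart_dom c p, chart_dom c' (f p) &
    forall w, exists v, 'd (in_charts c c' f) (c p) v = w].
Proof.
move=> /contrapT surj.
have [ac pc] := svalP (some_chart_at p).
pose c' := some_chart_at (f p); have [ac' pc'] := svalP c'.
exists (sval (some_chart_at p)), (sval c'); split => // w.
have [v' Tv' v'w] := tangent_vector_exists c' w.
by have [v _ vv'] := surj _ Tv'; exists (v (some_chart_at p)); rewrite -v'w -vv'.
Qed.

Lemma in_charts_domain_open (c : chart R m M) (c' : chart R n N) :
  open (c @` (chart_dom c `&` f @^-1` chart_dom c')).
Proof.
apply: chart_image_open; apply: open_comp; last exact: chart_dom_open.
by move=> x _; exact: C1f.1.
Qed.

(** In charts this is [C1_open_map]. It shows that a point of the range that is not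
    interior to it has only critical preimages. *)
Lemma regular_interior_range p : ~ critical_point f p -> nbhs (f p) (range f).
Proof.
move=> /regular_diff_surj[c [c' [ac ac' pc pc' surj]]].
pose D := c @` (chart_dom c `&` f @^-1` chart_dom c').
have Dcp : D (c p) by exists p.
have gp : in_charts c c' f (c p) = c' (f p).
  by rewrite /in_charts /= chartK.
have := C1_open_map (@in_charts_domain_open c c') Dcp (C1f.2 c c' ac ac') surj.
rewrite gp => /(@chart_map_continuous _ _ _ c' (f p) (mem_set pc')) near_gD.
have near_c' : nbhs (f p) (chart_dom c').
  by apply: open_nbhs_nbhs; split => //; exact: chart_dom_open.
apply: filterS (filterI near_c' near_gD) => y [c'y [_ [x [cx c'fx] <-]]].
rewrite /in_charts /= chartK // => fxy.
by exists x => //; exact: (chart_inj c'fx c'y fxy).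
Qed.

(** In charts, [f] is Lipschitz near [p], so that it maps the part of [C] near [p]
    to a null set. *)
Lemma locally_hnull_image (s : R) (C : set M) (c' : chart R n N) p :
  0 < s -> Hs_null s C -> atlas c' -> chart_dom c' (f p) ->
  exists U, [/\ open U, U p & hnull s ((c' \o f) @` (C `&` U))].
Proof.
move=> s0 nC ac' pc'; have [c [ac pc]] := atlas_cover p.
pose D := c @` (chart_dom c `&` f @^-1` chart_dom c').
have Dcp : D (c p) by exists p.
have [d [L [d0 L0 dD Llip]]] :=
  C1_locally_lipschitz (@in_charts_domain_open c c') Dcp (C1f.2 c c' ac ac').
have near_dom : nbhs p (chart_dom c).
  by apply: open_nbhs_nbhs; split => //; exact: chart_dom_open.
have near_ball : nbhs p (c @^-1` ball (c p) d).
  by apply: (@chart_map_continuous _ _ _ c p (mem_set pc)); exact: nbhsx_ballx.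
exists (interior (chart_dom c `&` c @^-1` ball (c p) d)); split.
- exact: open_interior.
- exact: filterI.
pose A := ball (c p) d `&` c @` (C `&` chart_dom c).
have nA : hnull s A.
  by apply: hnull_sub (hausdorff_hnull s0 (nC c ac)); exact: subIsetr.
apply: hnull_sub (hnull_lipschitz (g := in_charts c c' f) L0 _ nA); last first.
  by move=> x y [xb _] [yb _]; exact: Llip.
move=> _ [x [Cx /interior_subset[cx xb]] <-]; exists (c x).
  by split=> //; exists x.
by rewrite /in_charts /= chartK.
Qed.

Lemma compact_hnull_image (s : R) (C K : set M) (c' : chart R n N) :
  0 < s -> Hs_null s C -> atlas c' -> compact K -> K `<=` f @^-1` chart_dom c' ->
  hnull s ((c' \o f) @` (C `&` K)).
Proof.
move=> s0 nC ac' compactK Kc'.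
apply: (compact_local_property (P := fun A => hnull s ((c' \o f) @` (C `&` A)))
  _ _ _ compactK) => [|A B AB|A B nA nB|p Kp].
- by rewrite setI0 image_set0; exact: hnull0.
- by apply: hnull_sub => _ [x [Cx Ax] <-]; exists x => //; split => //; exact: AB.
- by rewrite setIUr image_setU; exact: hnullU.
have [U [oU Up nU]] := locally_hnull_image s0 nC ac' (Kc' p Kp).
by exists U => //; apply: open_nbhs_nbhs.
Qed.
End C1Maps.

(** * The critical set *)

(** In a connected space, the interior of [F] cannot be closed as well as open. A
    point [q] as below is a limit of interior points of [F] and also of points
    outside [F]. *)
Lemma frontier_point (T : topologicalType) (F : set T) :
  connected [set: T] -> interior F !=set0 ->
  F <> setT -> exists2 q, closure (interior F) q & ~ interior F q.
Proof.
move=> cT I0 FT; apply: contrapT => noq; apply: FT.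
have cI : closed (interior F).
  by move=> q Iq; apply: contrapT => nq; apply: noq; exists q.
have IT : interior F = setT.
  apply: cT => //.
    by exists (interior F); [exact: open_interior | rewrite setTI].
  by exists (interior F); [| rewrite setTI].
by rewrite eqEsubset; split => // x _; apply: interior_subset; rewrite IT.
Qed.

(** The crossing argument. Let [F] be the range of [f] and [q] a point of its frontier
    given by [frontier_point]. In a chart around [q], choose [pa] interior to [F]
    and [pb] outside [F]. Every segment obtained from the one that joins their
    images by a small translation starts in [F] and ends outside [F], so it contains
    a point of [F] that is not interior, which is a critical value; hence the
    image of the critical set contains too much to be null
    by [slab_not_hnull]. *)
Lemma critical_set_not_null (R : realType) (m n : nat) (M : manifold R m)
    (N : manifold R n) (f : M -> N) (p0 : M) (s : R) :
  compact [set: M] -> connected [set: N] -> ~ compact [set: N] -> C1_map f ->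
  ~ critical_point f p0 -> 0 < s -> s <= n%:R - 1 ->
  ~ Hs_null s [set p | critical_point f p].
Proof.
(* The bounds on [s] exclude [n = 0]. *)
case: n N f => [|k] N f cM cN ncN C1f reg s0; first by rewrite sub0r; lra.
rewrite -natr1 addrK => sk nC.
set F := range f; set C := [set p | critical_point f p] in nC.
have compactF : compact F.
  by apply: continuous_compact => //; apply: continuous_subspaceT; exact: C1f.1.
have closedF : closed F.
  by apply: compact_closed => //; exact: manifold_hausdorff.
have [q qI nqI] : exists2 q, closure (interior F) q & ~ interior F q.
  apply: frontier_point => //.
    by exists (f p0); exact: regular_interior_range.
  by move=> FT; apply: ncN; rewrite -FT.
have [c [ac qc]] := atlas_cover q.
have near_dom : nbhs q (chart_dom c).
  by apply: open_nbhs_nbhs; split => //; exact: chart_dom_open.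
have cqD : nbhs (c q) (c @` chart_dom c).
  by apply: open_nbhs_nbhs; split; [exact: chart_cod_open | exists q].
have [r0 r00 r0D] := (nbhs_ballP _ _).1 cqD.
have r10 : 0 < r0 / 2 by rewrite divr_gt0.
(* [Q] is the region, convex and compact, where the crossings take place. *)
pose r1 := r0 / 2.
pose Q := closed_ball (c q) r1.
have QD : Q `<=` c @` chart_dom c.
  by move=> y Qy; apply: r0D; exact: subset_closure_half Qy.
have near_small : nbhs q (c @^-1` ball (c q) (r1 / 2)).
  apply: (@chart_map_continuous _ _ _ c q (mem_set qc)).
  by apply: nbhsx_ballx; rewrite divr_gt0.
have near_q : nbhs q (chart_dom c `&` c @^-1` ball (c q) (r1 / 2)).
  exact: filterI.
have [pa [Fpa [pac pab]]] := qI _ near_q.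
have [pb [nFpb [pbc pbb]]] : exists pb, ~ F pb /\
    (chart_dom c `&` c @^-1` ball (c q) (r1 / 2)) pb.
  apply: contrapT => nopb; apply: nqI; apply: filterS near_q => x Ux.
  by apply: contrapT => nFx; apply: nopb; exists x.
have near_pa : nbhs pa F by exact: Fpa.
have near_pb : nbhs pb (~` F).
  by apply: open_nbhs_nbhs; split => //; exact: closed_openC.
have [da da0 daF] := (nbhs_ballP _ _).1 (nbhs_chart_inv pac near_pa).
have [db db0 dbF] := (nbhs_ballP _ _).1 (nbhs_chart_inv pbc near_pb).
rewrite /= in da0 db0.
(* [rho] bounds the translations: they keep the endpoints on their sides of the
   frontier and the segment in [Q]. *)
pose rho := Num.min (r1 / 2) (Num.min da db).
have rho0 : 0 < rho by rewrite !lt_min divr_gt0 // da0.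
have u0 : c pb - c pa != 0.
  rewrite subr_eq0; apply/eqP => pab'; apply: nFpb.
  by rewrite (chart_inj pbc pac pab'); exact: interior_subset.
(* Only the critical points in the compact set [K] matter for the crossings. *)
pose K := f @^-1` (chart_inv c @` Q).
have compactQ : compact Q.
  apply: bounded_closed_compact; last exact: closed_ball_closed.
  exists (`|c q| + r1); split; first exact: num_real.
  move=> x xM y; rewrite /Q closed_ballE // /closed_ball_ /= => yQ.
  apply: le_trans (ltW xM); rewrite -[y](subrK (c q)) addrC.
  by rewrite (le_trans (ler_normD _ _)) // lerD2l distrC.
have closedK : closed K.
  apply: closed_comp => [x _|]; first exact: C1f.1.
  apply: compact_closed; first exact: manifold_hausdorff.
  apply: continuous_compact compactQ; apply: continuous_in_subspaceT => y /set_mem Qy.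
  by apply: chart_inv_continuous; apply: mem_set; exact: QD.
have compactK : compact K by exact: subclosed_compact closedK cM _.
have Kc : K `<=` f @^-1` chart_dom c.
  by move=> x [y Qy fx]; rewrite /= -fx; apply: chart_inv_dom; exact: QD.
apply: (@slab_not_hnull R k s rho (c pa) (c pb - c pa) _ u0 rho0 s0 sk _
  (compact_hnull_image C1f s0 nC ac compactK Kc)).
move=> w; rewrite !lt_min => /and3P[wr wa wb].
pose gamma t := c pa + w + t *: (c pb - c pa).
have shift_ball y : ball (c q) (r1 / 2) y -> ball (c q) r1 (y + w).
  rewrite -!ball_normE /= => yr; rewrite opprD addrA.
  by rewrite (le_lt_trans (ler_normB _ _)) // [r1]splitr ltrD.
have gammaQ t : 0 <= t <= 1 -> Q (gamma t).
  move=> t01; apply: subset_closed_ball.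
  have -> : gamma t = c pa + w + t *: ((c pb + w) - (c pa + w)).
    by rewrite opprD addrACA subrr addr0.
  by apply: ball_convex t01; exact: shift_ball.
have gamma_cont t : {for t, continuous gamma}.
  apply: cvgD; first exact: cvg_cst.
  exact: scalel_continuous.
have phi_cont t : 0 <= t <= 1 -> {for t, continuous (chart_inv c \o gamma)}.
  move=> t01; apply: continuous_comp; first exact: gamma_cont.
  by apply: chart_inv_continuous; apply: mem_set; apply: QD; exact: gammaQ.
have start_in : F ((chart_inv c \o gamma) 0).
  have [|_ [+ _]] := daF (c pa + w); last by rewrite /= /gamma scale0r addr0.
  by rewrite -ball_normE /= opprD addrA subrr add0r normrN.
have end_out : ~ F ((chart_inv c \o gamma) 1).
  have [|_ [+ _]] := dbF (c pb + w).
    by rewrite -ball_normE /= opprD addrA subrr add0r normrN.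
  by rewrite /= /gamma scale1r addrAC [_ + (_ - _)]addrC subrK.
have [t [t01 [p _ fp] nF]] := path_meets_frontier closedF phi_cont start_in end_out.
exists t; exists p; last first.
  by rewrite /= fp /= chart_invK //; apply: QD; exact: gammaQ.
split; last by exists (gamma t); [exact: gammaQ | rewrite fp].
apply: contrapT => regp; apply: nF; rewrite -fp.
exact: regular_interior_range.
Qed.

Theorem corollary1p3 (R : realType) (m n : nat) (M : manifold R m)
    (N : manifold R n) (f : M -> N)
    (compactM : compact [set: M])
    (connectedN : connected [set: N])
    (noncompactN : ~ compact [set: N])
    (C1f : C1_map f) :
  (forall p : M, critical_point f p) \/
  ((n%:R - 1 : R)%:E <= dimension [set p : M | critical_point f p])%E.
Proof.
have [allcrit|] := pselect (forall p : M, critical_point f p); first by left.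
move=> /existsNP[p0 reg]; right; apply: le_ereal_inf_tmp => _ [s [s0 nC] <-].
rewrite lee_fin leNgt; apply/negP => sn.
exact: (critical_set_not_null compactM connectedN noncompactN C1f reg s0 (ltW sn)).
Qed.
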